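(* Let $\xi,x\in[0,1]$. Then $$G(\xi,x)=\sum_{\ell=1}^\infty\kappa^{\tau_\ell+1}\,g\big(B_2^{\tau_\ell}(\xi,x)\big).$$
   Context: Let $\gamma\in\,]\tfrac12,1[$ and $\kappa=\frac{1}{2\gamma}\in\,]\tfrac12,1[$. For $\xi\in[0,1]$ let $(\bar\xi_{-n})_{n\ge0}\in\{0,1\}^{\mathbb{N}}$ be its dyadic digits, $\xi=\sum_{n\ge0}\bar\xi_{-n}2^{-(n+1)}$; for a dyadic rational $\xi\neq0$ the expansion that is not eventually $0$ is chosen. The second components of the iterates of the baker's transformation are, for $k\ge0$, $$B_2^k(\xi,x)=\frac{\bar\xi_{-k+1}}{2}+\frac{\bar\xi_{-k+2}}{2^2}+\cdots+\frac{\bar\xi_0}{2^k}+\frac{x}{2^k},$$ and, for $k\ge1$, $B_2^{-k}(\xi,x)=2^kx\ (\mathrm{mod}\ 1)$. Define $$G(\xi,x)=2\pi\sum_{n\in\mathbb{Z}}\kappa^{-n}\big[\sin\big(2\pi B_2^{-n}(\xi,x)\big)-\sin\big(2\pi B_2^{-n}(0,x)\big)\big].$$ The upward jump times of $\xi$ are $\tau_1=\inf\{\ell\ge0:\bar\xi_{-\ell}=1\}$ and $\tau_{n+1}=\inf\{\ell>\tau_n:\bar\xi_{-\ell}=1\}$; terms with $\tau_\ell=\infty$ are read as $0$. The increment function is $$g(x)=4\pi\sum_{m=0}^\infty\kappa^m\sin\Big(\frac{\pi}{2^{m+1}}\Big)\cos\Big(\pi\frac{2x+1}{2^{m+1}}\Big),\quad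 x\in[0,1].$$ *)

(* Defs.v *)
From HB Require Import structures.
From mathcomp Require Import all_boot all_order all_algebra.
From mathcomp Require Import all_classical all_reals all_analysis.
From mathcomp Require Import ring lra.

Set Implicit Arguments.
Unset Strict Implicit.
Unset Printing Implicit Defensive.

Import Order.TTheory GRing.Theory Num.Theory numFieldNormedType.Exports.
Local Open Scope classical_set_scope.
Local Open Scope ring_scope.

Definition dyadic_rational (R : realType) (xi : R) : Prop :=
  exists (m : int) (n : nat), xi = m%:~R / 2 ^+ n.

(* [d n] is the digit of index [-n], i.e. the coefficient of 2^-(n+1). *)
Definition is_dyadic_expansion (R : realType) (xi : R) (d : nat -> bool) : Prop :=
  series (fun n => (d n)%:R / 2 ^+ n.+1 : R) @ \oo --> xi /\
  (dyadic_rational xi -> xi != 0 ->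
    ~ exists N : nat, forall n, (N <= n)%N -> d n = false).

(* Only meaningful on [0, 1], where the expansion exists and is unique
   ([digitsP] and [dyadic_expansion_inj] below). *)
Definition digits (R : realType) (xi : R) : nat -> bool :=
  xget (fun=> false) [set d | is_dyadic_expansion xi d].

Definition mod1 (R : realType) (y : R) : R := y - (Num.floor y)%:~R.

(* [Negz k] is the integer [- k.+1], so the second branch is the exponent
   -(k+1). *)
Definition B2 (R : realType) (k : int) (xi x : R) : R :=
  match k with
  | Posz k =>
      \sum_(1 <= j < k.+1) (digits xi (k - j)%N)%:R / 2 ^+ j + x / 2 ^+ k
  | Negz k => mod1 (2 ^+ k.+1 * x)
  end.

Definition cvg_sumZ (R : realType) (f : int -> R) : Prop :=
  cvgn (series (fun n : nat => f n%:Z)) /\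
  cvgn (series (fun n : nat => f (- n.+1%:Z))).

Definition sumZ (R : realType) (f : int -> R) : R :=
  limn (series (fun n : nat => f n%:Z)) +
  limn (series (fun n : nat => f (- n.+1%:Z))).

Definition G_term (R : realType) (kappa xi x : R) (n : int) : R :=
  kappa ^ (- n) *
  (sin (2 * pi * B2 (- n) xi x) - sin (2 * pi * B2 (- n) 0 x)).

Definition G (R : realType) (kappa xi x : R) : R :=
  2 * pi * sumZ (G_term kappa xi x).

(* The infimum of a set of naturals, [None] standing for [+oo = inf set0]. *)
Definition inf_nat (P : pred nat) : option nat :=
  match pselect (exists l, P l) with
  | left exP => Some (ex_minn exP)
  | right _ => None
  end.

(* Shifted by one: [jump_time xi n] is tau_(n+1). *)
Fixpoint jump_time (R : realType) (xi : R) (n : nat) : option nat :=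
  match n with
  | 0%N => inf_nat (fun l => digits xi l)
  | n'.+1 =>
      if jump_time xi n' is Some t
      then inf_nat (fun l => (t < l)%N && digits xi l)
      else None
  end.

Definition g_term (R : realType) (kappa x : R) (m : nat) : R :=
  kappa ^+ m * sin (pi / 2 ^+ m.+1) * cos (pi * ((2 * x + 1) / 2 ^+ m.+1)).

Definition g (R : realType) (kappa x : R) : R :=
  4 * pi * limn (series (g_term kappa x)).

Definition jump_term (R : realType) (kappa xi x : R) (n : nat) : R :=
  if jump_time xi n is Some t
  then kappa ^+ t.+1 * g kappa (B2 t%:Z xi x)
  else 0.

Section WellDefined.
Variable R : realType.
Implicit Types (xi x kappa : R) (d e : nat -> bool).

Let r2n0 n : (2 ^+ n : R) != 0. Proof. by rewrite expf_neq0. Qed.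
Let r2gt0 n : 0 < (2 ^+ n : R). Proof. by rewrite exprn_gt0. Qed.

Lemma dyadic_expansion_ex xi : 0 <= xi <= 1 ->
  exists d, is_dyadic_expansion xi d.
Proof.
move=> /andP[xi0 xi1].
have [xi_eq0|xi_neq0] := eqVneq xi 0.
  exists (fun=> false); split; last by rewrite xi_eq0 eqxx.
  rewrite xi_eq0.
  rewrite (_ : series _ = fun=> 0); first exact: cvg_cst.
  by apply/funext => n; rewrite /series /= big1// => i _; rewrite mul0r.
have {xi_neq0}xi0 : 0 < xi by rewrite lt_neqAle eq_sym xi_neq0.
pose b (y : R) : bool := 2^-1 < y.
pose r := fix r n : R := if n is n'.+1 then 2 * r n' - (b (r n'))%:R else xi.
have r01 n : 0 < r n <= 1.
  elim: n => [|n /andP[h0 h1]]; first by rewrite /= xi0.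
  by rewrite /= /b; case: (ltP 2^-1 (r n)) => h /=; apply/andP; split; lra.
pose d n := b (r n).
have seriesE n : series (fun n => (d n)%:R / 2 ^+ n.+1 : R) n
                 = xi - r n / 2 ^+ n.
  elim: n => [|n IH]; first by rewrite /series /= big_geq// expr0; lra.
  rewrite /series /= big_nat_recr//= -[X in X + _]/(series _ n) IH.
  rewrite /d exprS; set c := (b _)%:R.
  by have := r2n0 n => h; field.
exists d; split.
  apply/cvgrPdist_le => e e0.
  have : (fun n => 1 * 2^-1 ^+ n : R) @ \oo --> (0 : R).
    by apply: cvg_geometric; rewrite ger0_norm; lra.
  move=> /cvgrPdist_le /(_ e e0); apply: filterS => n.
  rewrite seriesE sub0r normrN mul1r opprB addrCA subrr addr0 => h.
  apply: le_trans h; have /andP[h0 h1] := r01 n.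
  rewrite !ger0_norm ?exprn_ge0// ?divr_ge0 ?(ltW h0) ?(ltW (r2gt0 _))//.
  by rewrite exprVn ler_piMl// invr_ge0 ltW.
move=> _ _ [N Nd].
have rN m : r (N + m)%N = 2 ^+ m * r N.
  elim: m => [|m IH]; first by rewrite addn0 expr0 mul1r.
  rewrite addnS /= -/(d (N + m)%N) Nd ?leq_addr// subr0 IH exprS; ring.
have /andP[rN0 _] := r01 N.
have : (fun n => 1 * 2^-1 ^+ n : R) @ \oo --> (0 : R).
  by apply: cvg_geometric; rewrite ger0_norm; lra.
move=> /cvgrPdist_lt /(_ _ rN0) [m _ /(_ m (leqnn m))] /=.
rewrite sub0r normrN mul1r ger0_norm ?exprn_ge0// exprVn => h.
have /andP[_] := r01 (N + m)%N; rewrite rN leNgt => /negP; apply.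
by rewrite -[ltLHS](mulfV (r2n0 m)) ltr_pM2l.
Qed.

Lemma digitsP xi : 0 <= xi <= 1 -> is_dyadic_expansion xi (digits xi).
Proof. by move=> /dyadic_expansion_ex; exact: xgetPex. Qed.

Let term_ge0 d n : 0 <= (d n)%:R / 2 ^+ n.+1 :> R.
Proof. by rewrite divr_ge0// ltW. Qed.

Let partial_le d xi n : is_dyadic_expansion xi d ->
  series (fun n => (d n)%:R / 2 ^+ n.+1 : R) n <= xi.
Proof.
move=> [dxi _]; rewrite -(cvg_lim _ dxi)//; apply: nondecreasing_cvgn_le.
  by apply/nondecreasing_seqP => k; rewrite /series /= big_nat_recr//= lerDl.
by apply/cvg_ex; exists xi.
Qed.

Let tail_le d n m : series (fun n => (d n)%:R / 2 ^+ n.+1 : R) (n + m)%N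
  <= series (fun n => (d n)%:R / 2 ^+ n.+1 : R) n + (1 - 2^- m) / 2 ^+ n.
Proof.
elim: m => [|m IH]; first by rewrite addn0 expr0 invr1 subrr mul0r addr0.
rewrite addnS /series /= big_nat_recr//= -[X in X + _ <= _]/(series _ _).
rewrite -[X in _ <= X + _]/(series _ _); set S := series _ n in IH *.
have : (d (n + m)%N)%:R / 2 ^+ (n + m).+1 <= 1 / 2 ^+ (n + m).+1 :> R.
  by rewrite ler_pM2r ?invr_gt0//; case: (d _).
move=> h; apply: le_trans (lerD IH h) _.
rewrite le_eqVlt; apply/orP; left; apply/eqP.
rewrite !exprS exprD; have := r2n0 n; have := r2n0 m => hm hn.
by field; rewrite hm hn.
Qed.

Let le_tail d xi n : is_dyadic_expansion xi d ->
  xi <= series (fun n => (d n)%:R / 2 ^+ n.+1 : R) n + 1 / 2 ^+ n.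
Proof.
move=> [dxi _]; rewrite -(cvg_lim _ dxi)//; apply: limr_le.
  by apply/cvg_ex; exists xi.
exists n => // k /= /subnKC <-.
apply: le_trans (tail_le d n (k - n)) _.
by rewrite lerD2l ler_pM2r ?invr_gt0// gerBl invr_ge0 ltW.
Qed.

Let neg_ev0 d xi : is_dyadic_expansion xi d -> xi != 0 ->
  ~ exists N : nat, forall n, (N <= n)%N -> d n = false.
Proof.
move=> dxi xi0 [N Nd]; case: (dxi) => cv /(_ _ xi0); apply; last by exists N.
pose S := series (fun n => (d n)%:R / 2 ^+ n.+1 : R).
have SN : xi = S N.
  rewrite -(cvg_lim _ cv)//; apply: lim_near_cst => //.
  exists N => // k /= /subnKC <-; elim: (k - N)%N => [|m IH]; first by rewrite addn0.
  by rewrite addnS /series /= big_nat_recr//= Nd ?leq_addr// mul0r addr0.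
have [m Sm] : exists m : int, S N = m%:~R / 2 ^+ N.
  elim: (N) => [|n [m Sm]].
    by exists 0; rewrite /S /series /= big_geq// mul0r.
  exists (2 * m + (d n)%:Z).
  rewrite /S /series /= big_nat_recr//= -[X in X + _]/(S n) Sm.
  rewrite rmorphD rmorphM/= exprS -pmulrn; have := r2n0 n => h.
  by field.
by exists m, N; rewrite SN.
Qed.

Lemma dyadic_expansion_inj xi d e :
  is_dyadic_expansion xi d -> is_dyadic_expansion xi e -> d = e.
Proof.
have key d' e' n : is_dyadic_expansion xi d' -> is_dyadic_expansion xi e' ->
    (forall k, (k < n)%N -> d' k = e' k) -> d' n -> e' n.
  move=> dx ex eqn dn; apply/negPn/negP => en.
  pose S d := series (fun n => (d n)%:R / 2 ^+ n.+1 : R).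
  have eqS : S d' n = S e' n.
    rewrite /S /series /= !big_mkord; apply: eq_bigr => i _.
    by rewrite eqn.
  have xi0 : xi != 0.
    apply/eqP => xi0; have := partial_le n.+1 dx.
    rewrite xi0 leNgt => /negP; apply.
    rewrite /series /= big_nat_recr//= dn.
    rewrite ltr_wpDl ?divr_gt0//; exact: sumr_ge0.
  apply: (neg_ev0 dx xi0); exists n.+1 => k nk.
  apply/negbTE/negP => dk.
  have := partial_le k.+1 dx; have := le_tail n.+1 ex.
  have SkE : S d' n.+1 + 1 / 2 ^+ k.+1 <= S d' k.+1.
    rewrite /S [X in _ <= X]/series /= big_nat_recr//= dk lerD2r.
    rewrite -(subnKC nk); elim: (k - n.+1)%N => [|m IH]; first by rewrite addn0.
    by rewrite addnS big_nat_recr//=; apply: le_trans IH _; rewrite lerDl.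
  have Sd : S d' n.+1 = S d' n + 1 / 2 ^+ n.+1.
    by rewrite /S /series /= big_nat_recr//= dn.
  have Se : S e' n.+1 = S e' n.
    by rewrite /S /series /= big_nat_recr//= (negbTE en) mul0r addr0.
  have : 0 < 1 / 2 ^+ k.+1 :> R by rewrite divr_gt0.
  move: SkE Sd Se eqS; rewrite /S; lra.
move=> dx ex; apply/funext => n.
elim/ltn_ind: n => n IH; apply/idP/idP; first exact: key dx ex IH.
by apply: key ex dx _ => k /IH.
Qed.

Lemma cvg_g_term kappa x : 0 <= kappa < 1 -> cvgn (series (g_term kappa x)).
Proof.
move=> /andP[k0 k1]; apply: normed_cvg.
apply: (@series_le_cvg _ _ (geometric 1 kappa)).
- by move=> n /=.
- by move=> n; rewrite /= mulr_ge0 ?exprn_ge0.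
- move=> n /=; rewrite /g_term -mulrA normrM mul1r ger0_norm ?exprn_ge0//.
  rewrite ler_piMr ?exprn_ge0// normrM mulr_ile1// ler_norml.
    by rewrite sin_geN1 sin_le1.
  by rewrite cos_geN1 cos_le1.
- by apply: is_cvg_geometric_series; rewrite ger0_norm.
Qed.

Lemma cvg_G_term kappa xi x : 0 <= kappa < 1 ->
  cvg_sumZ (G_term kappa xi x).
Proof.
move=> /andP[k0 k1]; split.
  rewrite (_ : series _ = fun=> 0); first exact: is_cvg_cst.
  apply/funext => n; rewrite /series /= big1// => -[|i] _.
    rewrite /G_term oppr0 (_ : B2 0 xi x = B2 0 0 x) ?subrr ?mulr0//.
    by rewrite /B2 /= !big_geq.
  by rewrite /G_term /= subrr mulr0.
apply: normed_cvg.
apply: (@series_le_cvg _ _ (geometric (2 * kappa) kappa)).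
- by move=> n /=.
- by move=> n; rewrite /= mulr_ge0 ?exprn_ge0// mulr_ge0.
- move=> n /=; rewrite /G_term opprK normrM -exprnP ger0_norm ?exprn_ge0//.
  rewrite (_ : 2 * kappa * _ = 2 * kappa ^+ n.+1); last by rewrite exprS mulrA.
  rewrite mulrC ler_wpM2r ?exprn_ge0//.
  apply: le_trans (ler_normB _ _) _.
  by rewrite (_ : 2 = 1 + 1 :> R)// lerD// ler_norml sin_geN1 sin_le1.
- by apply: is_cvg_geometric_series; rewrite ger0_norm.
Qed.

End WellDefined.

(* Main.v *)
(* With [y_k = B2^k(xi, x)] one has [y_(k+1) = (digit_k + y_k) / 2].  Let
   [phi y = \sum_m kappa^m sin (2 pi y / 2^m)], so that
   [phi y = sin (2 pi y) + kappa phi (y / 2)]; the product formula for a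
   difference of sines gives [g y = 2 pi (phi ((y + 1) / 2) - phi (y / 2))].
   Whatever the digit, it follows that
   [digit_t kappa^(t+1) g y_t
    = 2 pi (kappa^(t+1) phi y_(t+1) - kappa^t phi y_t + kappa^t sin (2 pi y_t))],
   which telescopes over [t]: the boundary term at infinity vanishes because
   [phi] is bounded, and the one at [0] is [- phi x], i.e. the sum of the
   [- kappa^t sin (2 pi B2^t(0, x))]. *)
Require Import Defs.
From mathcomp Require Import all_boot all_order all_algebra.
From mathcomp Require Import all_classical all_reals all_analysis.
From mathcomp Require Import ring lra.

Import Order.TTheory GRing.Theory Num.Theory numFieldNormedType.Exports.
Local Open Scope classical_set_scope.
Local Open Scope ring_scope.

(** * Sums over jumps as sums over times *)

Lemma inf_natP (P : pred nat) :
  match inf_nat P with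
  | Some t => P t /\ forall l, (l < t)%N -> ~~ P l
  | None => forall l, ~~ P l
  end.
Proof.
rewrite /inf_nat; case: pselect => [exP|nexP].
  case: ex_minnP => t Pt tmin; split=> // l; apply: contraTN => /tmin.
  by rewrite -leqNgt.
by move=> l; apply/negP => Pl; apply: nexP; exists l.
Qed.

Lemma series_stable {R : realType} (c : nat -> R) (m n : nat) : (m <= n)%N ->
  (forall i, (m <= i < n)%N -> c i = 0) -> series c n = series c m.
Proof.
move=> mn c0; rewrite /series /= (big_cat_nat _ mn)//=.
by rewrite [X in _ + X]big_nat [X in _ + X]big1 ?addr0.
Qed.

(** The index [N] need not be monotone in [n]: the bound [n <= N] alone sends it to infinity. This
    covers the case of finitely many jumps as well. *)
Lemma cvgn_subvalues {R : realType} (u v : nat -> R) (l : R) :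
  (forall n, exists2 N, (n <= N)%N & u n = v N) ->
  v @ \oo --> l -> u @ \oo --> l.
Proof.
move=> uv /cvgrPdist_lt vl; apply/cvgrPdist_lt => e /vl[K _ Kv].
exists K => // n /= Kn; have [N nN ->] := uv n.
by apply: Kv; exact: leq_trans nN.
Qed.

Lemma series_jump {R : realType} (xi : R) (F : nat -> R) (n : nat) :
  exists2 N, (n <= N)%N &
    series (fun n => if jump_time xi n is Some t then F t else 0) n =
    series (fun t => if digits xi t then F t else 0) N.
Proof.
pose u n := if jump_time xi n is Some t then F t else 0.
pose c t := if digits xi t then F t else 0.
rewrite -/u -/c.
(* Invariant strong enough for induction. If [t] is the jump of index [n], the earlier jumps are
   exactly the nonzero digits before [t], so [N = t] works; [n <= t] because jump times strictly
   increase. If there is no such jump, the sum over times is eventually constant. *)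
suff: match jump_time xi n with
    | Some t => [/\ (n <= t)%N, digits xi t & series u n = series c t]
    | None => exists M, forall N, (M <= N)%N -> series u n = series c N
    end.
  case: jump_time => [t [nt _ ->]|[M Mu]]; first by exists t.
  by exists (maxn M n); [exact: leq_maxr|apply: Mu; exact: leq_maxl].
have u0 : series u 0 = series c 0 by rewrite /series /= !big_geq.
elim: n => [|n IH] /=.
  have := inf_natP (digits xi); case: inf_nat => [t [dt tmin]|d0].
    split=> //; rewrite u0; apply/esym/series_stable => // i /andP[_ it].
    by rewrite /c (negbTE (tmin i it)).
  exists 0%N => N _; rewrite u0; apply/esym/series_stable => // i _.
  by rewrite /c (negbTE (d0 i)).
case jE: (jump_time xi n) IH => [t|]; last first.
  move=> [M Mu]; exists M => N /Mu <-.
  by rewrite seriesSr /u jE addr0.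
move=> [nt dt IH].
have uS : series u n.+1 = series c t.+1.
  by rewrite !seriesSr IH /u /c jE dt.
have := inf_natP (fun l => (t < l)%N && digits xi l).
case: inf_nat => [t' [/andP[tt' dt'] tmin]|d0].
  split=> //; first exact: leq_ltn_trans tt'.
  rewrite uS; apply/esym/series_stable => // i /andP[ti it'].
  by have := tmin i it'; rewrite ti /c /= => /negbTE ->.
exists t.+1 => N tN; rewrite uS; apply/esym/series_stable => // i /andP[ti _].
by have := d0 i; rewrite ti /c /= => /negbTE ->.
Qed.

(** * Values of the iterates [B2] *)

Lemma digits0 {R : realType} : digits (0 : R) = fun=> false.
Proof.
have r01 : 0 <= (0 : R) <= 1 by rewrite lexx ler01.
(* The convention on dyadic rationals exempts 0, so the zero sequence is admissible. *)
apply: dyadic_expansion_inj (digitsP r01) _; split; last by rewrite eqxx.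
rewrite (_ : series _ = fun=> 0); first exact: cvg_cst.
by apply/funext => n; rewrite /series /= big1// => i _; rewrite mul0r.
Qed.

Lemma B2_zero {R : realType} (x : R) (k : nat) : B2 k%:Z 0 x = x / 2 ^+ k.
Proof. by rewrite /B2 digits0 big1 ?add0r// => j _; rewrite mul0r. Qed.

Lemma B2_exp0 {R : realType} (xi x : R) : B2 0%N%:Z xi x = x.
Proof. by rewrite /B2 big_geq// add0r expr0 divr1. Qed.

Lemma B2S {R : realType} (xi x : R) (k : nat) :
  B2 k.+1%:Z xi x = ((digits xi k)%:R + B2 k%:Z xi x) / 2.
Proof.
rewrite /B2 big_nat_recl//= subn1/= expr1 !mulrDl -addrA; congr (_ + (_ + _)).
  rewrite mulr_suml; apply: eq_bigr => j _.
  by rewrite subSS exprSr invfM mulrA.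
by rewrite exprSr invfM mulrA.
Qed.

(** * The function [phi] and telescoping *)

Definition phi_term {R : realType} (kappa y : R) (m : nat) : R :=
  kappa ^+ m * sin (2 * pi * (y / 2 ^+ m)).

Definition phi {R : realType} (kappa y : R) : R :=
  limn (series (phi_term kappa y)).

Section Phi.
Context {R : realType} (kappa : R).
Hypothesis kappa01 : 0 <= kappa < 1.

Let phi_term_le (y : R) m : `|phi_term kappa y m| <= geometric 1 kappa m.
Proof.
have /andP[k0 _] := kappa01.
rewrite normrM ger0_norm ?exprn_ge0//= mulrC ler_wpM2r ?exprn_ge0//.
by rewrite ler_norml sin_geN1 sin_le1.
Qed.

Let cvg_geo : cvgn (series (geometric 1 kappa)).
Proof. by apply: is_cvg_geometric_series; case/andP: kappa01 => ? ?; rewrite ger0_norm. Qed.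

Let cvg_norm_phi (y : R) : cvgn [normed series (phi_term kappa y)].
Proof.
have /andP[k0 _] := kappa01.
apply: (series_le_cvg _ _ (phi_term_le y) cvg_geo) => n; first exact: normr_ge0.
by rewrite /= mul1r exprn_ge0.
Qed.

Lemma cvg_phi (y : R) : cvgn (series (phi_term kappa y)).
Proof. exact: normed_cvg. Qed.

(** Uniformity in [y] matters: in the boundary term the argument of [phi] moves with [N]. *)
Lemma phi_bound (y : R) : `|phi kappa y| <= limn (series (geometric 1 kappa)).
Proof.
apply: le_trans (lim_series_norm _) _; first exact: cvg_norm_phi.
exact: lim_series_le (cvg_norm_phi y) cvg_geo (phi_term_le y).
Qed.

Lemma phi_rec (y : R) :
  phi kappa y = sin (2 * pi * y) + kappa * phi kappa (y / 2).
Proof.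
apply/cvg_lim => //; rewrite -(cvg_shiftn 1).
rewrite [X in X @ _](_ : _ = (fun n => sin (2 * pi * y) +
    kappa * series (phi_term kappa (y / 2)) n)); last first.
  apply/funext => n; rewrite /series /= addn1 big_nat_recl//.
  rewrite {1}/phi_term expr0 divr1 mul1r mulr_sumr; congr (_ + _).
  by apply: eq_bigr => i _; rewrite /phi_term !exprS invfM !mulrA.
by apply: cvgD; [exact: cvg_cst|apply: cvgMl_tmp; exact: cvg_phi].
Qed.

Lemma g_phi (y : R) :
  g kappa y = 2 * pi * (phi kappa ((y + 1) / 2) - phi kappa (y / 2)).
Proof.
have sinB (a b : R) : sin (b + a) - sin (b - a) = 2 * (sin a * cos b).
  by rewrite sinB sinD; ring.
rewrite [in RHS]/phi -limB; [|exact: cvg_phi..].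
rewrite (_ : _ - _ = 2 *: series (g_term kappa y)); last first.
  apply/funext => n; rewrite !fctE /series /= -sumrB scaler_sumr.
  apply: eq_bigr => m _; rewrite /phi_term /g_term -mulrBr.
  (* The two angles are [b + a] and [b - a] with [a = pi / 2 ^+ m.+1] and
     [b = pi * ((2 * y + 1) / 2 ^+ m.+1)]. *)
  rewrite [LHS](_ : _ = kappa ^+ m * (2 * (sin (pi / 2 ^+ m.+1) *
    cos (pi * ((2 * y + 1) / 2 ^+ m.+1))))); last first.
    rewrite -sinB; congr (_ * (sin _ - sin _));
      by rewrite exprS; field; rewrite expf_neq0.
  by rewrite -[RHS]/(2 * _); ring.
rewrite limZl_tmp; last exact: cvg_g_term.
by rewrite -[_ *: _]/(2 * _) /g; ring.
Qed.

(* For a zero digit both sides vanish, by [phi_rec] and [B2S]. *)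
Lemma jump_telescope (xi x : R) (t : nat) :
  (if digits xi t then kappa ^+ t.+1 * g kappa (B2 t%:Z xi x) else 0) =
  2 * pi * (kappa ^+ t.+1 * phi kappa (B2 t.+1%:Z xi x)
            - kappa ^+ t * phi kappa (B2 t%:Z xi x)
            + kappa ^+ t * sin (2 * pi * B2 t%:Z xi x)).
Proof.
rewrite (phi_rec (B2 t%:Z xi x)) B2S; case: digits => /=.
  by rewrite g_phi exprS [1%:R + _]addrC; ring.
by rewrite add0r exprS; ring.
Qed.

Lemma series_jump_telescope (xi x : R) (N : nat) :
  series (fun t => if digits xi t then kappa ^+ t.+1 * g kappa (B2 t%:Z xi x)
                   else 0) N =
  2 * pi * (kappa ^+ N * phi kappa (B2 N%:Z xi x) - phi kappa x
            + series (fun t => kappa ^+ t * sin (2 * pi * B2 t%:Z xi x)) N).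
Proof.
elim: N => [|N IH].
  by rewrite B2_exp0 expr0 /series /= !big_geq//; ring.
by rewrite !seriesSr IH jump_telescope; ring.
Qed.

(** * Passage to the limit *)

Lemma cvg_kappa_phi (y : nat -> R) :
  (fun N => kappa ^+ N * phi kappa (y N)) @ \oo --> 0.
Proof.
have /andP[k0 k1] := kappa01.
set C := limn (series (geometric 1 kappa)).
have cC : (fun N => C * kappa ^+ N) @ \oo --> 0.
  by apply: cvg_geometric; rewrite ger0_norm.
apply: norm_cvg0; apply: squeeze_cvgr (cvg_cst 0) cC.
apply: nearW => N; rewrite normr_ge0 normrM ger0_norm ?exprn_ge0//= mulrC.
by rewrite ler_wpM2r ?exprn_ge0// phi_bound.
Qed.

(** At indices [n >= 0] the exponent [- n] is at most 0, where [B2] does not depend on [xi], so the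
    sines cancel. On the remaining half, [B2_zero] turns the second sine into a term of
    [phi kappa x]. *)
Lemma cvg_G (xi x : R) :
  2 * pi * (series (fun t => kappa ^+ t * sin (2 * pi * B2 t%:Z xi x)) N
    - series (phi_term kappa x) N) @[N --> \oo] --> G kappa xi x.
Proof.
have nonneg0 : series (fun n : nat => G_term kappa xi x n%:Z) = fun=> 0.
  apply/funext => n; rewrite /series /= big1// => -[|i] _.
    by rewrite /G_term oppr0 !B2_exp0 subrr mulr0.
  by rewrite /G_term /= subrr mulr0.
rewrite /G /sumZ nonneg0 lim_cst// add0r; apply: cvgMl_tmp.
(* The term [t = 0] vanishes, both sines being taken at [x]; dropping it matches [t = n.+1] with the
   index [- n.+1]. *)
rewrite -(cvg_shiftn 1).
have [_ cvG] := cvg_G_term xi x kappa01.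
rewrite [X in X @ _](_ : _ = series (fun n => G_term kappa xi x (- n.+1%:Z)))//.
apply/funext => n; rewrite /mk_sequence addn1 /series -sumrB big_nat_recl//.
rewrite /phi_term -!B2_zero !B2_exp0 subrr add0r; apply: eq_bigr => i _.
by rewrite -B2_zero -mulrBr /G_term opprK.
Qed.

End Phi.

Theorem proposition3p4 (R : realType) (gamma kappa : R)
    (gamma_bound : 1 / 2 < gamma < 1) (kappaE : kappa = 1 / (2 * gamma))
    (xi x : R) (xi01 : 0 <= xi <= 1) (x01 : 0 <= x <= 1) :
  series (jump_term kappa xi x) @ \oo --> G kappa xi x.
Proof.
have kappa01 : 0 <= kappa < 1.
  have /andP[g1 _] := gamma_bound.
  rewrite kappaE div1r invr_ge0 invf_lt1; last by lra.
  by apply/andP; split; lra.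
apply: cvgn_subvalues (series_jump xi _) _.
(* A partial sum of [phi kappa x] is added and subtracted: the first summand collects the boundary
   term and the tail of [phi kappa x], both tending to 0, and the second is the sequence of
   [cvg_G]. *)
rewrite (_ : series _ = fun N =>
    2 * pi * (kappa ^+ N * phi kappa (B2 N%:Z xi x)
              - (phi kappa x - series (phi_term kappa x) N))
    + 2 * pi * (series (fun t => kappa ^+ t * sin (2 * pi * B2 t%:Z xi x)) N
                - series (phi_term kappa x) N)); last first.
  by apply/funext => N; rewrite series_jump_telescope//; ring.
rewrite -[G _ _ _]add0r; apply: cvgD; last exact: cvg_G.
rewrite -(mulr0 (2 * pi)) -(subr0 0); apply: cvgMl_tmp.
apply: cvgB; first exact: cvg_kappa_phi.
rewrite -(subrr (phi kappa x)).
by apply: cvgB; [exact: cvg_cst|exact: cvg_phi].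
Qed.
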